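(* Let $n$ be odd, let $k$ be a positive integer with $\gcd(k,n)=1$, and let $L=GF(2^n)$. Let $f(x)=x^{2^{2k}-2^k+1}$ and $g(x)=x^{2^{4k}-2^{3k}+2^{2k}-2^k+1}$. Let $C$ be the binary code of length $2^n-1$ whose coordinates are indexed by $x\in L^*$ and which consists of all $(c_x)_{x\in L^*}\in GF(2)^{L^*}$ with $$\sum_{x\in L^*} c_x\,x=0,\qquad \sum_{x\in L^*} c_x\,f(x)=0,\qquad \sum_{x\in L^*} c_x\,g(x)=0 .$$ Then $C$ is a triple error correcting code with BCH parameters, i.e. $C$ has parameters $[2^n-1,\,2^n-3n-1,\,7]$ (length $2^n-1$, dimension $2^n-3n-1$, minimum Hamming distance $7$), and its weight distribution equals that of the binary primitive triple error correcting BCH code of length $2^n-1$.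
   Context: $L^*=L\setminus\{0\}$. Equivalently, $C$ is the nullspace of the $3n\times(2^n-1)$ binary matrix whose column indexed by $x\in L^*$ consists of the coordinate vectors (with respect to a fixed basis of $L$ over $GF(2)$) of $x$, $f(x)$ and $g(x)$ stacked on top of each other.
   Formalization: The theorem is proved for odd n at least 5; for n = 1 and n = 3 the claim is false as stated, since the asserted dimension 2^n − 3n − 1 would be −2. *)

(* Defs.v *)
From HB Require Import structures.
From mathcomp Require Import all_boot all_order all_algebra all_field.
Set Implicit Arguments. Unset Strict Implicit. Unset Printing Implicit Defensive.
Import GRing.Theory.
Local Open Scope ring_scope.

Definition Lstar (L : finFieldType) : finType := {x : L | x != 0}.

Definition word (L : finFieldType) := {ffun Lstar L -> 'F_2}.

Definition csum (L : finFieldType) (c : word L) (e : nat) : L :=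
  \sum_(x : Lstar L) ((c x : nat)%:R * (val x) ^+ e).

Definition code3 (L : finFieldType) (e1 e2 e3 : nat) : {set word L} :=
  [set c : word L | [&& csum c e1 == 0, csum c e2 == 0 & csum c e3 == 0]].

Definition wt (L : finFieldType) (c : word L) : nat := #|[set x | c x != 0]|.

Definition hdist (L : finFieldType) (c d : word L) : nat :=
  #|[set x | c x != d x]|.

Definition min_dist (L : finFieldType) (C : {set word L}) (d : nat) : Prop :=
  (exists c1, exists c2, [/\ c1 \in C, c2 \in C, c1 != c2 & hdist c1 c2 = d]) /\
  (forall c1 c2, c1 \in C -> c2 \in C -> c1 != c2 -> (d <= hdist c1 c2)%N).

(* the binary primitive triple error correcting BCH code of length |L|-1:
   zeros alpha, alpha^3, alpha^5 (and their conjugates) *)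
Definition BCH3 (L : finFieldType) : {set word L} := code3 L 1 3 5.

Definition ef (k : nat) : nat := (2 ^ (2 * k) - 2 ^ k + 1)%N.
Definition eg (k : nat) : nat :=
  (2 ^ (4 * k) - 2 ^ (3 * k) + 2 ^ (2 * k) - 2 ^ k + 1)%N.

(* Main.v *)
(* As [n] is odd, [y |-> y^(q+1)] with [q = 2^k] permutes [L], and it turns the
   exponents of [C] into [q+1], [q^3+1], [q^5+1].  The Walsh sums of [C] thus
   become exponential sums of quadratic forms whose polar kernels are root sets
   of [q^2]-linearized polynomials with at most six terms, so have at most [2^5]
   elements; hence the sums lie in [{0, +-A, +-2A, +-4A}], [A = 2^((n+1)/2)].
   For the BCH code the sums lie in this set as well.  Both codes have minimum
   distance at least 7, so the first seven moments (of orders 0 to 6) of their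
   Walsh sums agree; seven possible values being determined by seven moments,
   all moments agree, and these determine the weight distribution.  Dimension
   and a word of weight 7 are then read off the BCH code. *)
Require Import Defs.
From HB Require Import structures.
From mathcomp Require Import all_boot all_order all_fingroup all_algebra all_field.
From mathcomp Require Import ring zify.
Import Order.TTheory GRing.Theory Num.Theory.
Local Open Scope ring_scope.
Set Implicit Arguments. Unset Strict Implicit. Unset Printing Implicit Defensive.

(** * Linearized polynomials over a binary field *)

Definition frob (L : finFieldType) (j : nat) (x : L) : L := x ^+ (2 ^ j).

Section BinaryField.
Variables (L : finFieldType) (n : nat).
Hypotheses (hL : #|L| = (2 ^ n)%N).

Lemma pchar2L : 2%N \in [pchar L].
Proof. exact: card_finPcharP hL isT. Qed.

Lemma addLL (x : L) : x + x = 0.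
Proof. exact: addrr_pchar2 pchar2L x. Qed.

Lemma oppL (x : L) : - x = x.
Proof. exact: oppr_pchar2 pchar2L x. Qed.

Lemma frob0r (x : L) : frob 0 x = x.
Proof. by rewrite /frob expn0 expr1. Qed.

Lemma frobD j : {morph @frob L j : x y / x + y}.
Proof.
move=> x y; rewrite /frob exprDn_pchar // (eq_pnat _ (pcharf_eq pchar2L)).
by rewrite pnatX pnat_id.
Qed.

Lemma frobM j : {morph @frob L j : x y / x * y}.
Proof. by move=> x y; rewrite /frob exprMn. Qed.

Lemma frob0 j : frob j (0 : L) = 0.
Proof. by rewrite /frob expr0n expn_eq0. Qed.

Lemma frob_eq0 j (x : L) : (frob j x == 0) = (x == 0).
Proof. by rewrite /frob expf_eq0 expn_gt0. Qed.

Lemma frobV j (x : L) : frob j x^-1 = (frob j x)^-1.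
Proof. by rewrite /frob exprVn. Qed.

Lemma frob_sum j (I : Type) (r : seq I) (P : pred I) (F : I -> L) :
  frob j (\sum_(i <- r | P i) F i) = \sum_(i <- r | P i) frob j (F i).
Proof. exact: (big_morph _ (frobD j) (frob0 j)). Qed.

Lemma frobK i j (x : L) : frob i (frob j x) = frob (i + j) x.
Proof. by rewrite /frob -exprM -expnD addnC. Qed.

Lemma frob_n (x : L) : frob n x = x.
Proof. by rewrite /frob -hL expf_card. Qed.

Lemma frob_mul_fix j m (x : L) : frob j x = x -> frob (m * j) x = x.
Proof.
by move=> fx; elim: m => [|m IH]; rewrite ?frob0r // mulSn -frobK IH.
Qed.

Lemma frobMn m (x : L) : frob (m * n) x = x.
Proof. exact/frob_mul_fix/frob_n. Qed.

(** As [frob n] fixes everything, Bezout makes the Frobenius map itself fix [x], which is then a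
    root of X^2 - X. *)
Lemma frob_fixP m (x : L) : coprime m n -> frob m x = x -> (x == 0) || (x == 1).
Proof.
move=> co fx.
have fx1 : frob 1 x = x.
  have [m0|mn0] := eqVneq m 0%N.
    move: co; rewrite m0 /coprime gcd0n => /eqP n1.
    by rewrite -{2}(frob_n x) n1.
  have [|u v E _] := egcdnP n (_ : 0 < m)%N; first by rewrite lt0n.
  move/eqP: (co) => G; rewrite -[RHS](frob_mul_fix u fx) E G addnC -frobK.
  by rewrite frobMn.
have: x * (x - 1) == 0 by rewrite mulrBr mulr1 -expr2 [_ ^+ 2]fx1 subrr.
by rewrite mulf_eq0 subr_eq0.
Qed.

(** Abel summation, with the signs removed by characteristic 2. *)
Lemma sum_by_parts (b : nat -> L) (f : nat -> L) D :
  \sum_(i < D.+1) b i * f i =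
  \sum_(i < D) (\sum_(j < i.+1) b j) * (f i.+1 + f i)
    + (\sum_(j < D.+1) b j) * f D.
Proof.
elim: D => [|D IH]; first by rewrite !big_ord_recr !big_ord0 /= !add0r.
rewrite big_ord_recr /= IH [in RHS]big_ord_recr /=.
rewrite [\sum_(j < D.+2) b j]big_ord_recr /=.
set s := \sum_(j < D.+1) b j; set A := \sum_(i < D) _.
rewrite -[LHS]addr0 -(addLL (s * f D.+1)); ring.
Qed.

(* Dividing by a root [e] on the right: [z |-> a (e z)] factors through the
   additive map [z |-> frob m z + z], whose kernel is the prime field. *)
Lemma card_linearized_roots m d (a : nat -> L) : coprime m n ->
  (exists2 i, (i <= d)%N & a i != 0) ->
  (#|[set z : L | \sum_(i < d.+1) a i * frob (m * i) z == 0 :> L]%R| <= 2 ^ d)%N.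
Proof.
move=> co; elim: d a => [|d IH] a [i0 i0d ai0].
  apply: (@leq_trans #|[set (0 : L)]|); last by rewrite cards1.
  apply/subset_leq_card/subsetP => z; move: i0d ai0; rewrite leqn0 => /eqP -> a0.
  by rewrite !inE big_ord_recl big_ord0 addr0 mulf_eq0 (negPf a0) frob_eq0.
set R := [set z | _].
have [R0|] := eqVneq (R :\ 0) set0.
  apply: (@leq_trans #|[set (0 : L)]|); last by rewrite cards1 expn_gt0.
  by apply: subset_leq_card; rewrite -setD_eq0 R0.
case/set0Pn => e; rewrite !inE => /andP[e0 /eqP Re].
(* The [b i] are the coefficients of z |-> a (e z) and the partial sums [g i] those of its quotient;
   the last partial sum is the remainder, the value of a at [e]. *)
pose b i := a i * frob (m * i) e.
pose g i := \sum_(j < i.+1) b j.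
have gd : g d.+1 = 0 by exact: Re.
pose h (y : L) := let z := y / e in frob m z + z.
pose T := [set w : L | \sum_(i < d.+1) g i * frob (m * i) w == 0].
have hT y : y \in R -> h y \in T.
  rewrite !inE => /eqP Ry; apply/eqP.
  transitivity (\sum_(i < d.+2) b i * frob (m * i) (y / e)).
    rewrite (sum_by_parts b (fun i => frob (m * i) (y / e))) -/(g d.+1) gd mul0r addr0.
    apply: eq_bigr => i _; congr (_ * _).
    by rewrite frobD frobK mulnS addnC.
  rewrite -[RHS]Ry; apply: eq_bigr => i _.
  by rewrite /b -mulrA -frobM mulrCA mulfV // mulr1.
have gT : (#|T| <= 2 ^ d)%N.
  apply: IH; case: (boolP [exists i : 'I_d.+1, g i != 0]).
    by case/existsP => i gi; exists (i : nat) => //; rewrite -ltnS.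
  (* If every [g i] vanished, so would the differences [b i], against [a i0 != 0]. *)
  rewrite negb_exists => /forallP g0.
  have g0' i : (i <= d.+1)%N -> g i = 0.
    rewrite leq_eqVlt => /predU1P[-> //|lt]; apply/eqP.
    by have := g0 (Ordinal lt); rewrite negbK.
  have b0 : b i0 = 0.
    case: i0 i0d {ai0} => [|i] id.
      by have := g0' 0%N isT; rewrite /g big_ord_recl big_ord0 addr0.
    have := g0' _ id; rewrite /g big_ord_recr /= -/(g i) g0' ?add0r //.
    exact: ltnW.
  by move/eqP: b0; rewrite mulf_eq0 (negPf ai0) frob_eq0 (negPf e0).
(* [R] is counted by the fibres of [h]: two points of one fibre differ by 0 or [e]. *)
rewrite -sum1_card (partition_big h [in T]) //=.
apply: (@leq_trans (\sum_(w in T) 2)); last first.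
  by rewrite sum_nat_const mulnC expnS leq_mul2l.
apply: leq_sum => w _; rewrite sum1dep_card.
have [->|] := eqVneq [set x in R | h x == w] set0; first by rewrite cards0.
case/set0Pn => y0; rewrite inE => /andP[_ /eqP <-].
apply: (@leq_trans #|[set y0; y0 + e]|); last by rewrite cards2; case: eqP.
apply/subset_leq_card/subsetP => y; rewrite !inE => /andP[_ /eqP hy].
have : frob m (y / e + y0 / e) = y / e + y0 / e.
  apply: (addIr (y / e + y0 / e)); rewrite frobD addrACA addLL.
  by move: hy; rewrite /h /= => ->; rewrite addLL.
move/(frob_fixP co); rewrite -mulrDl mulf_eq0 invr_eq0 (negPf e0) orbF.
case/orP => [|/eqP E]; first by rewrite -{1}[y0]oppL subr_eq0 => ->.
have yy : y + y0 = e by rewrite -[LHS](mulfVK e0) E mul1r.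
by apply/orP; right; rewrite -yy addrCA addLL addr0.
Qed.

End BinaryField.

(** * Power sums and minimum distance *)

Section PowerSums.
Variables (L : finFieldType) (n : nat).
Hypotheses (hL : #|L| = (2 ^ n)%N) (n_gt0 : (0 < n)%N).

Lemma frob_sum_expr j e (S : {set L}) :
  frob j (\sum_(x in S) x ^+ e) = \sum_(x in S) x ^+ (e * 2 ^ j).
Proof. by rewrite (frob_sum hL); apply: eq_bigr => x _; rewrite exprM. Qed.

(* The polynomial [X * \prod_(y in S :\ y0) (X - y)] has no constant term and
   degree at most 6, so its values on [S] sum to 0, yet only the value at [y0]
   is nonzero. *)
Lemma power_sums135_eq0 (S : {set L}) : 0 \notin S -> (#|S| <= 6)%N ->
  \sum_(x in S) x ^+ 1 = 0 -> \sum_(x in S) x ^+ 3 = 0 ->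
  \sum_(x in S) x ^+ 5 = 0 -> S = set0.
Proof.
move=> S0 cS s1 s3 s5; apply/eqP; apply: contraT => /set0Pn [y0 Sy0].
(* The even power sums are Frobenius images of the odd ones. *)
have s2 : \sum_(x in S) x ^+ 2 = 0.
  by have := frob_sum_expr 1 1 S; rewrite s1 frob0.
have s4 : \sum_(x in S) x ^+ 4 = 0.
  by have := frob_sum_expr 2 1 S; rewrite s1 frob0.
have s6 : \sum_(x in S) x ^+ 6 = 0.
  by have := frob_sum_expr 1 3 S; rewrite s3 frob0.
pose R := enum (S :\ y0).
pose P : {poly L} := 'X * \prod_(y <- R) ('X - y%:P).
have sR : (size R).+1 = #|S| by rewrite -cardE (cardsD1 y0 S) Sy0.
have sP : (size P <= 7)%N.
  rewrite /P mulrC size_mulX ?size_prod_XsubC ?sR //.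
  by rewrite -size_poly_eq0 size_prod_XsubC.
have P0 : P`_0 = 0 by rewrite /P coefXM.
have : \sum_(x in S) P.[x] = 0.
  under eq_bigr => x _ do rewrite (horner_coef_wide x sP).
  rewrite exchange_big /= !big_ord_recl big_ord0 -!mulr_sumr /=.
  by rewrite P0 s1 s2 s3 s4 s5 s6 mul0r !mulr0 !addr0.
rewrite (bigD1 y0) //= big1 ?addr0; last first.
  move=> y /andP[Sy ny]; apply/eqP; rewrite /P hornerM mulf_eq0; apply/orP; right.
  by rewrite -/(root _ _) root_prod_XsubC mem_enum !inE ny.
move/eqP; rewrite /P hornerM hornerX mulf_eq0 -/(root _ _) root_prod_XsubC.
rewrite mem_enum !inE eqxx orbF => /eqP y00.
by rewrite -y00 Sy0 in S0.
Qed.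

Lemma frobMnD k i m (x : L) : frob (k * (i + n * m)) x = frob (k * i) x.
Proof. by rewrite mulnDr -frobK (mulnC n) mulnA (frobMn hL). Qed.

(** A nonzero left kernel vector is padded with zeros to length 4, so that dependences among 3 and
    among 4 vectors take the same form. *)
Lemma row_dependence k m D w (y : 'I_w -> L) : (D <= 4)%N ->
  ~~ row_free (\matrix_(r < D, j < w) frob (k * (2 * r + m)) (y j)) ->
  exists2 c : nat -> L, exists2 i, (i < 4)%N & c i != 0 &
    forall j, \sum_(i < 4) c i * frob (k * (2 * i + m)) (y j) = 0.
Proof.
move=> D4; rewrite -kermx_eq0 => /rowV0Pn [u /sub_kermxP uM u0].
have [i ui] : exists i, u 0 i != 0.
  apply/existsP; apply: contraR u0; rewrite negb_exists => /forallP u0.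
  by apply/eqP/rowP => i; rewrite mxE; apply/eqP; have := u0 i; rewrite negbK.
pose c (j : nat) : L := if insub j is Some r then u 0 r else 0.
exists c; first by exists i; rewrite ?(leq_trans _ D4) // /c valK.
move=> j; have /rowP/(_ j) := uM; rewrite !mxE => uMj.
rewrite -[RHS]uMj.
rewrite -(big_mkord xpredT (fun i => c i * frob (k * (2 * i + m)) (y j))).
rewrite (big_cat_nat (leq0n D) D4) //= big_mkord [X in _ + X]big1_seq ?addr0.
  by apply: eq_bigr => r _; rewrite mxE /c valK.
move=> r; rewrite mem_index_iota => /andP[_ /andP[Dr _]].
by rewrite /c insubF ?mul0r // ltnNge Dr.
Qed.

Lemma max_nonzero (c : nat -> L) N : (exists2 i, (i < N)%N & c i != 0) ->
  exists b, [/\ (b < N)%N, c b != 0 & forall i, (b < i < N)%N -> c i = 0].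
Proof.
elim: N => [|N IH] [i iN ci]; first by [].
have [cN|cN] := eqVneq (c N) 0; last first.
  by exists N; split=> // j; rewrite ltnS ltnNge => /andP[/negPf->].
case: IH => [|b [bN cb hb]].
  exists i => //; rewrite ltn_neqAle -ltnS iN andbT.
  by apply: contraNneq ci => ->; rewrite cN.
exists b; split=> //; first exact: ltnW.
move=> j /andP[bj]; rewrite ltnS leq_eqVlt => /predU1P[->//|jN].
by apply: hb; rewrite bj.
Qed.

(* With [v_i = (frob (k i) y)_(y in S)], the vectors [v_1, v_3, v_5] are
   orthogonal to [v_0, v_2, v_4, v_6]; as 3 + 4 > |S|, one of the two families
   is dependent.  The resulting recurrence [v_(t+2b) \in <v_t, v_(t+2), ...>]
   propagates [v_0 _|_ v_1, v_3, v_5] to all odd indices, hence, the indices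
   being cyclic of odd period [n], to all indices. *)
Lemma kasami_sums_eq0 k (S : {set L}) : odd n -> (0 < k)%N -> coprime k n ->
  0 \notin S -> (#|S| <= 6)%N ->
  \sum_(x in S) x * frob k x = 0 -> \sum_(x in S) x * frob (k * 3) x = 0 ->
  \sum_(x in S) x * frob (k * 5) x = 0 -> S = set0.
Proof.
move=> nodd k0 co S0 cS s1 s3 s5.
pose ip i j := \sum_(x in S) frob (k * i) x * frob (k * j) x.
have ipC i j : ip i j = ip j i by apply: eq_bigr => x _; rewrite mulrC.
have ipD t i j : ip (t + i)%N (t + j)%N = frob (k * t) (ip i j).
  rewrite /ip (frob_sum hL); apply: eq_bigr => x _.
  by rewrite frobM !frobK -!mulnDr.
have ip0 j : (j < 3)%N -> ip 0%N (2 * j + 1)%N = 0.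
  rewrite /ip muln0; under eq_bigr => x _ do rewrite frob0r.
  by case: j => [|[|[|]]] // _; rewrite ?muln1.
(* Up to a Frobenius power [ip] depends only on the difference of the indices, here odd and at most
   5 in absolute value. *)
have ip_near i j : (i < 3)%N -> (j < 4)%N -> ip (2 * i + 1)%N (2 * j + 0)%N = 0.
  move=> i3 j4; have [ji|ij] := leqP j i.
    have := ipD (2 * j)%N 0%N (2 * (i - j) + 1)%N; rewrite ip0 ?frob0; last lia.
    by rewrite ipC => <-; congr ip; lia.
  have := ipD (2 * i + 1)%N 0%N (2 * (j - i - 1) + 1)%N; rewrite ip0 ?frob0; last lia.
  by move=> <-; congr ip; lia.
pose y (j : 'I_#|S|) : L := enum_val j.
have [m [c c0 dep]] : exists m, exists2 c : nat -> L,
  exists2 i, (i < 4)%N & c i != 0 &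
    forall j, \sum_(i < 4) c i * frob (k * (2 * i + m)) (y j) = 0.
  pose M D m := \matrix_(r < D, j < #|S|) frob (k * (2 * r + m)) (y j).
  case: (boolP (row_free (M 3 1%N))) => [fA|nf]; last first.
    by exists 1%N; apply: row_dependence nf.
  case: (boolP (row_free (M 4 0%N))) => [fB|nf]; last first.
    by exists 0%N; apply: row_dependence nf.
  (* If both families were free, this product would force 3 + 4 <= [#|S|]. *)
  have /mulmx0_rank_max : M 3 1%N *m (M 4 0%N)^T = 0.
    apply/matrixP => i j; rewrite !mxE -[RHS](ip_near i j) // /ip [RHS]big_enum_val.
    by apply: eq_bigr => r _; rewrite !mxE.
  by rewrite mxrank_tr (eqP fA) (eqP fB) => /leq_trans/(_ cS).
have [b [b4 cb hb]] := max_nonzero c0.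
have rec t : exists g : nat -> L, forall x, x \in S ->
  frob (k * (2 * b + t)) x = \sum_(i < b) g i * frob (k * (2 * i + t)) x.
  (* Solve the dependence for its leading term [b], then shift it from base index [m] to [t]; modulo
     [n], the number [n.-1 * m] stands for -m. *)
  exists (fun i => frob (k * (t + n.-1 * m)) (c i / c b)) => x Sx.
  have shift i : frob (k * (t + n.-1 * m)) (frob (k * (2 * i + m)) x)
                 = frob (k * (2 * i + t)) x.
    rewrite frobK -mulnDr -[RHS](frobMnD k _ m); congr (frob (k * _) x).
    have -> : (n * m = m + n.-1 * m)%N by rewrite -mulSn prednK.
    lia.
  rewrite -shift; under eq_bigr => i _ do rewrite -shift -frobM.
  rewrite -(frob_sum hL); congr frob.
  have := dep (enum_rank_in Sx x); rewrite /y enum_rankK_in //.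
  rewrite -(big_mkord xpredT (fun i => c i * frob (k * (2 * i + m)) x)).
  rewrite (big_cat_nat (leq0n b.+1) b4) /= [X in _ + X]big1_seq ?addr0; last first.
    by move=> i; rewrite mem_index_iota => /andP[_ hi]; rewrite hb // mul0r.
  rewrite big_mkord big_ord_recr /= => /eqP.
  rewrite addrC addr_eq0 (oppL hL) => /eqP E.
  apply: (mulfI cb); rewrite E mulr_sumr; apply: eq_bigr => i _.
  by rewrite mulrA mulrCA mulfV // mulr1.
have ip_odd j : ip 0%N (2 * j + 1)%N = 0.
  have [N] := ubnP j; elim: N j => // N IH j jN.
  have [j3|j3] := ltnP j 3; first exact: ip0.
  have [g hg] := rec (2 * (j - b) + 1)%N.
  transitivity (\sum_(i < b) g i * ip 0%N (2 * (i + j - b) + 1)%N).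
    rewrite /ip; under [RHS]eq_bigr => i _ do rewrite mulr_sumr.
    rewrite exchange_big; apply: eq_bigr => x Sx /=.
    rewrite (_ : 2 * j + 1 = 2 * b + (2 * (j - b) + 1))%N; last lia.
    rewrite hg // mulr_sumr; apply: eq_bigr => i _.
    rewrite mulrCA; congr (_ * (_ * frob (k * _) x)); lia.
  apply: big1 => i _; rewrite IH ?mulr0 //; have := ltn_ord i; lia.
have ip_all l : ip 0%N l = 0.
  case: (boolP (odd l)) => [ol|el].
    have := ip_odd l./2; rewrite mul2n -[X in (_ + X)%N]/(nat_of_bool true) -ol.
    by rewrite addnC odd_double_half.
  (* For even [l] the index [l + n] is odd and gives the same Frobenius power. *)
  have := ip_odd (l + n)./2; rewrite mul2n addn1.
  have -> : ((l + n)./2.*2).+1 = (l + n * 1)%N.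
    by rewrite muln1 -[RHS]odd_double_half oddD nodd (negPf el).
  by rewrite /ip; under eq_bigr => x _ do rewrite frobMnD.
(* As [k] is invertible modulo [n], multiples of [k] reach every Frobenius power; l = 0, 1, 2 then
   give the sums of x^2, x^3, x^5. *)
have all_sums l : \sum_(x in S) x * frob l x = 0.
  have [u v E _] := egcdnP n k0.
  rewrite -[RHS](ip_all (l * u)%N) /ip; apply: eq_bigr => x _.
  rewrite muln0 frob0r; congr (_ * _).
  have -> : (k * (l * u) = l + l * v * n)%N.
    by rewrite mulnCA (mulnC k) E (eqP co) mulnDr muln1 mulnA addnC.
  by rewrite -frobK (frobMn hL).
apply: power_sums135_eq0 => //.
- apply/eqP; rewrite -(frob_eq0 1) frob_sum_expr -[X in _ == X](all_sums 0%N).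
  by apply/eqP/eq_bigr => x _; rewrite frob0r -expr2.
- by rewrite -[RHS](all_sums 1%N); apply: eq_bigr => x _; rewrite exprS.
- by rewrite -[RHS](all_sums 2%N); apply: eq_bigr => x _; rewrite exprS.
Qed.

End PowerSums.

(** * Exponential sums of quadratic forms *)

Section ExponentialSums.
Variables (L : finFieldType) (n : nat).
Hypotheses (hL : #|L| = (2 ^ n)%N) (n_gt0 : (0 < n)%N).

(** The absolute trace, kept with values in [L]. *)
Definition tr (x : L) : L := \sum_(i < n) frob i x.

Lemma trD : {morph tr : x y / x + y}.
Proof. by move=> x y; rewrite -big_split; apply: eq_bigr => i _; apply: (frobD hL). Qed.

Lemma tr_frob j x : tr (frob j x) = tr x.
Proof.
elim: j => [|j IH]; first by rewrite frob0r.
rewrite -[j.+1]add1n -frobK -IH /tr; move: (frob j x) => y.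
case: n n_gt0 (frob_n hL) => // p _ fp.
rewrite big_ord_recr [RHS]big_ord_recl /= frob0r frobK addn1 fp addrC.
by congr (_ + _); apply: eq_bigr => i _; rewrite frobK addn1.
Qed.

Lemma tr01 x : (tr x == 0) || (tr x == 1).
Proof.
apply: (frob_fixP hL (coprime1n n)).
rewrite -[RHS](tr_frob 1) /tr (frob_sum hL); apply: eq_bigr => i _.
by rewrite !frobK addnC.
Qed.

Definition chi (x : L) : int := if tr x == 0 then 1 else -1.

Lemma chiD : {morph chi : x y / x + y >-> x * y}.
Proof.
move=> x y; rewrite /chi trD.
case/orP: (tr01 x) => /eqP->; case/orP: (tr01 y) => /eqP->;
  by rewrite ?add0r ?addr0 ?(addLL hL) ?eqxx ?oner_eq0.
Qed.

Lemma chi_frob j x : chi (frob j x) = chi x.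
Proof. by rewrite /chi tr_frob. Qed.

Lemma chi0 : chi 0 = 1.
Proof. by rewrite /chi /tr big1 ?eqxx // => i _; rewrite frob0. Qed.

Lemma chi_pm1 x : (chi x == 1) || (chi x == -1).
Proof. by rewrite /chi; case: ifP. Qed.

(** For odd [n] the trace of 1 is 1, so for nonzero [a] translating [x] by [a^-1] negates the
    sum. *)
Lemma sum_chi_mul a : odd n ->
  \sum_(x : L) chi (x * a) = if a == 0 then (2 ^ n)%:Z else 0.
Proof.
move=> nodd; have [->|a0] := eqVneq a 0.
  under eq_bigr => x _ do rewrite mulr0 chi0.
  by rewrite sumr_const hL natz.
have chi1 : chi 1 = -1.
  rewrite /chi /tr (_ : \sum_(i < n) _ = 1) ?oner_eq0 //.
  under eq_bigr => i _ do rewrite /frob expr1n.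
  rewrite sumr_const card_ord -(odd_double_half n) nodd mulrS -mul2n mulrnA.
  by rewrite mulr2n (addLL hL) mul0rn addr0.
apply/eqP; rewrite -eqNr; apply/eqP.
rewrite [in RHS](reindex_inj (addIr a^-1)) -mulN1r mulr_sumr /=.
by apply: eq_bigr => x _; rewrite mulrDl mulVf // chiD chi1 mulrC.
Qed.

(** * Signs of a quadratic form with polar form Tr (y * Lam z) and radical [K] *)

Section Quadratic.
Variables (f : L -> int) (Lam : L -> L).
Hypothesis f_pm1 : forall x, (f x == 1) || (f x == -1).
Hypothesis LamD : {morph Lam : x y / x + y}.
Hypothesis fD : forall y z, f (y + z) = f y * f z * chi (y * Lam z).
Let K := [set z | Lam z == 0].

Lemma f_sqr x : f x * f x = 1.
Proof. by case/orP: (f_pm1 x) => /eqP->. Qed.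

(** Expanding the square and summing over [y] first leaves 2^n times the sum of [f] over [K]; on [K]
    the function [f] is a character, trivial or of sum 0. *)
Lemma quadratic_sum_sqr : odd n ->
  \sum_x f x = 0 \/ (\sum_x f x) ^+ 2 = (2 ^ n * #|K|)%:Z.
Proof.
move=> nodd; have E : (\sum_x f x) ^+ 2 = (2 ^ n)%:Z * \sum_(z in K) f z.
  transitivity (\sum_z f z * \sum_y chi (y * Lam z)).
    rewrite expr2 mulr_suml; under [RHS]eq_bigr => z _ do rewrite mulr_sumr.
    rewrite [RHS]exchange_big /=; apply: eq_bigr => y _.
    rewrite (reindex_inj (addrI y)) mulr_sumr /=; apply: eq_bigr => z _.
    by rewrite fD !mulrA f_sqr mul1r.
  rewrite mulr_sumr [RHS]big_mkcond; apply: eq_bigr => z _.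
  by rewrite (sum_chi_mul _ nodd) inE; case: eqP => _; rewrite ?mulr0 // mulrC.
have [/exists_inP[z0 Kz0 /eqP fz0]|] := boolP [exists z in K, f z == -1]; last first.
  rewrite negb_exists_in => /forall_inP f1; right; rewrite E PoszM; congr (_ * _).
  rewrite (eq_bigr (fun=> 1)) ?sumr_const ?natz // => z Kz.
  by have := f_pm1 z; rewrite (negPf (f1 z Kz)) orbF => /eqP.
left; apply/eqP; rewrite -sqrf_eq0 E mulf_eq0; apply/orP; right.
rewrite -eqNr; apply/eqP.
rewrite [in RHS](reindex_inj (addIr z0)) -mulN1r mulr_sumr /=.
move: Kz0; rewrite inE => /eqP Lz0.
apply: eq_big => z; first by rewrite !inE LamD Lz0 addr0.
by move=> _; rewrite fD Lz0 mulr0 chi0 fz0 mulr1 mulrC.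
Qed.

(** Lagrange's theorem for the additive group of [L]. *)
Lemma card_kernel_pow2 : exists r, #|K| = (2 ^ r)%N.
Proof.
have Lam0 : Lam 0 = 0 by apply: (addIr (Lam 0)); rewrite -LamD !add0r.
have gK : group_set K.
  apply/group_setP; split; first by rewrite inE; apply/eqP/Lam0.
  by move=> x y; rewrite !inE => /eqP Kx /eqP Ky; rewrite LamD Kx Ky addr0.
have : (#|Group gK| %| #|[set: L]|)%N by apply: cardSg; apply: subsetT.
rewrite cardsT hL => /dvdn_pfactor -/(_ isT) [r _ Kr].
by exists r.
Qed.

End Quadratic.

End ExponentialSums.

Definition walsh_values (n : nat) : seq int :=
  let A := (2 ^ n.+1./2)%:Z in
  [:: 0; A; - A; A * 2; - (A * 2); A * 4; - (A * 4)].

(** Since n + r is even and [n] odd, [r] is 1, 3 or 5, whence the three absolute values. *)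
Lemma mem_walsh_values (n : nat) (W : int) r : odd n -> (r <= 5)%N ->
  W ^+ 2 = (2 ^ n * 2 ^ r)%:Z -> W \in walsh_values n.
Proof.
move=> nodd r5 WW; have absW : (`|W| ^ 2 = 2 ^ (n + r))%N.
  by rewrite expnD; apply/eqP; rewrite -eqz_nat -WW -abszX; lia.
have lW := congr1 (logn 2) absW; rewrite lognX pfactorK // in lW.
have aW : `|W|%N = (2 ^ logn 2 `|W|)%N.
  have : (`|W| %| 2 ^ (n + r))%N by rewrite -absW dvdn_exp.
  by case/(dvdn_pfactor _ _ (isT : prime 2)) => s _ ->; rewrite pfactorK.
have hn : n.+1 = (n.+1./2).*2 by rewrite -[LHS]odd_double_half /= nodd.
have [j j3 lj] : exists2 j, (j < 3)%N & logn 2 `|W| = (n.+1./2 + j)%N.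
  by exists (logn 2 `|W| - n.+1./2)%N; lia.
rewrite lj expnD in aW; rewrite /walsh_values !inE.
by case: j aW j3 {lj} => [|[|[|]]] // aW _; lia.
Qed.

(** * Moments and weight distributions *)

Lemma F2_cases (x : 'F_2) : (x == 0) || (x == 1).
Proof. by case: x => [[|[|]]]. Qed.

(* Being roots of the monic [\prod_(v <- s) (X - v)], the values satisfy a
   linear recurrence of order [size s], and so do their power sums. *)
Lemma eq_power_sums (U : finType) (D : pred U) (s : seq int) (f g : U -> int) :
  (forall u, D u -> f u \in s) -> (forall u, D u -> g u \in s) ->
  (forall i, (i < size s)%N -> \sum_(u | D u) f u ^+ i = \sum_(u | D u) g u ^+ i) ->
  forall i, \sum_(u | D u) f u ^+ i = \sum_(u | D u) g u ^+ i.
Proof.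
move=> fs gs fg i; have [m] := ubnP i; elim: m i => // m IH i im.
have [/fg //|di] := ltnP i (size s).
pose P := \prod_(v <- s) ('X - v%:P).
have sP : size P = (size s).+1 by rewrite size_prod_XsubC.
have Pd : P`_(size s) = 1.
  by have /monicP := monic_prod_XsubC s xpredT id; rewrite lead_coefE -/P sP.
have rec (h : U -> int) : (forall u, D u -> h u \in s) ->
  \sum_(u | D u) h u ^+ i =
  - \sum_(t < size s) P`_t * \sum_(u | D u) h u ^+ (i - size s + t).
  move=> hs; apply/eqP; rewrite -addr_eq0; apply/eqP.
  under [X in _ + X]eq_bigr => t _ do rewrite mulr_sumr.
  rewrite [X in _ + X]exchange_big -big_split big1 //= => u Du.
  transitivity (h u ^+ (i - size s) * P.[h u]); last first.
    have : root P (h u) by rewrite root_prod_XsubC hs.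
    by move/eqP => ->; rewrite mulr0.
  rewrite horner_coef sP big_ord_recr /= Pd mul1r mulrDr -exprD subnK //.
  rewrite addrC mulr_sumr; congr (_ + _).
  by apply: eq_bigr => t _; rewrite exprD mulrCA.
rewrite !rec //; congr (- _); apply: eq_bigr => t _; congr (_ * _).
apply: IH; have := ltn_ord t; lia.
Qed.

(* The number of walks of length [i] in the hypercube of dimension [N] from a
   vertex of weight [w] to the origin. *)
Fixpoint cube_walks (N i w : nat) : nat :=
  if i is i'.+1 then w * cube_walks N i' w.-1 + (N - w) * cube_walks N i' w.+1
  else (w == 0).

(** A step lowers the weight by at most one. *)
Lemma cube_walks_gt N i w : (i < w)%N -> cube_walks N i w = 0%N.
Proof.
elim: i w => [|i IH] w iw /=; first by case: w iw.
by rewrite !IH ?muln0 //; lia.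
Qed.

Lemma cube_walks_diag N i : cube_walks N i i = (i`!)%N.
Proof.
by elim: i => //= i IH; rewrite IH cube_walks_gt ?muln0 ?addn0 // factS.
Qed.

(** * Binary words and walks in the hypercube *)

Section Words.
Variable L : finFieldType.
Implicit Types c d : word L.

Definition delta (x : Lstar L) : word L := [ffun y => (y == x)%:R].

Lemma addF2 (x : 'F_2) : x + x = 0.
Proof. by case/orP: (F2_cases x) => /eqP->; apply/eqP. Qed.

Lemma addcc c : c + c = 0.
Proof. by apply/ffunP => x; rewrite !ffunE addF2. Qed.

Lemma add_word_eq0 c d : (c + d == 0) = (c == d).
Proof. by rewrite -(inj_eq (addIr d)) -addrA addcc addr0 add0r. Qed.

Lemma wt_eq0 c : (wt c == 0%N) = (c == 0).
Proof.
rewrite /wt cards_eq0; apply/eqP/eqP => [E|->].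
  apply/ffunP => x; rewrite ffunE; apply/eqP; apply: contraT => cx.
  by have := in_set0 x; rewrite -E inE cx.
by apply/setP => x; rewrite !inE ffunE eqxx.
Qed.

Lemma wt_add_delta c x :
  wt (c + delta x) = if c x == 0 then (wt c).+1 else (wt c).-1.
Proof.
rewrite /wt; case: ifP => cx.
  rewrite (cardsD1 x) !inE !ffunE (eqP cx) eqxx add0r oner_eq0 add1n; congr _.+1.
  apply: eq_card => y; rewrite !inE !ffunE.
  by have [->|_] := eqVneq y x; rewrite ?addr0 // cx.
rewrite [in RHS](cardsD1 x) !inE cx add1n /=.
apply: eq_card => y; rewrite !inE !ffunE.
have [->|_] := eqVneq y x; last by rewrite addr0.
by case/orP: (F2_cases (c x)) => /eqP E; rewrite E // in cx *.
Qed.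

(** First-step decomposition: [wt c] of the flips lower the weight, the others raise it. *)
Lemma sum_cube_walks_delta i c :
  (\sum_x cube_walks #|Lstar L| i (wt (c + delta x)%R) =
   cube_walks #|Lstar L| i.+1 (wt c))%N.
Proof.
rewrite (bigID [pred x | c x != 0]) /=; congr (_ + _)%N.
  under eq_bigr => x /negPf cx do rewrite wt_add_delta cx.
  rewrite sum_nat_const; congr (_ * _)%N; rewrite /wt.
  by apply: eq_card => x; rewrite !inE.
under eq_bigr => x; first by rewrite negbK => cx; rewrite wt_add_delta cx; over.
rewrite sum_nat_const; congr (_ * _)%N.
rewrite -[#|Lstar L|](cardC [pred x | c x != 0]).
rewrite (_ : wt c = #|[pred x | c x != 0]|); last by apply: eq_card => x; rewrite !inE.
by rewrite addKn; apply: eq_card => x; rewrite !inE.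
Qed.

(** The power expands over sequences of [i] unit vectors, which are grouped by their sum [c]. *)
Lemma character_sum_expr (psi : word L -> int) i :
  psi 0 = 1 -> {morph psi : c d / c + d >-> c * d} ->
  (\sum_x psi (delta x)) ^+ i =
  \sum_(c : word L) (cube_walks #|Lstar L| i (wt c))%:Z * psi c.
Proof.
move=> psi0 psiD; elim: i => [|i IH].
  rewrite expr0 (bigD1 (0 : word L)) //= big1 ?addr0 => [|c c0].
    by rewrite psi0 (_ : wt 0 = 0%N) //; apply/eqP; rewrite wt_eq0.
  by rewrite wt_eq0 (negPf c0) mul0r.
rewrite exprS IH mulr_suml.
transitivity (\sum_x \sum_(c : word L)
  (cube_walks #|Lstar L| i (wt (c + delta x)))%:Z * psi c).
  apply: eq_bigr => x _; rewrite mulr_sumr [LHS](reindex_inj (addIr (delta x))).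
  apply: eq_bigr => c _ /=; rewrite mulrCA -psiD; congr (_ * psi _).
  by rewrite addrCA addcc addr0.
rewrite exchange_big; apply: eq_bigr => c _ /=.
rewrite -mulr_suml; congr (_ * _).
rewrite -(big_morph Posz PoszD (erefl : Posz 0 = 0)).
exact: congr1 (sum_cube_walks_delta i c).
Qed.

(** The walk counts form a triangular matrix in (i, w) with diagonal w!, so the weights are
    recovered by induction. *)
Lemma eq_weight_distribution (C D : {set word L}) :
  (forall i, (\sum_(c in C) cube_walks #|Lstar L| i (wt c) =
              \sum_(c in D) cube_walks #|Lstar L| i (wt c))%N) ->
  forall w, #|[set c in C | wt c == w]| = #|[set c in D | wt c == w]|.
Proof.
move=> CD w; have [m] := ubnP w; elim: m w => // m IH w wm.
pose A (E : {set word L}) v := #|[set c in E | wt c == v]|.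
have split_sum (E : {set word L}) : (\sum_(c in E) cube_walks #|Lstar L| w (wt c) =
  \sum_(v < w) A E v * cube_walks #|Lstar L| w v + A E w * w`!)%N.
  rewrite -(cube_walks_diag #|Lstar L|).
  rewrite -(big_ord_recr w (fun v => A E v * cube_walks #|Lstar L| w v)%N).
  rewrite (bigID (fun c => (wt c < w.+1)%N)) /= [X in (_ + X)%N]big1 ?addn0; last first.
    by move=> c /andP[_]; rewrite -leqNgt => /cube_walks_gt.
  rewrite (partition_big (fun c => inord (wt c) : 'I_w.+1) xpredT) //=.
  apply: eq_bigr => v _; rewrite -sum_nat_const; apply: eq_big => [c|c].
    rewrite !inE -andbA; congr (_ && _); apply/andP/eqP => [[lt /eqP <-]|->].
      by rewrite inordK.
    by rewrite inord_val.
  by move=> /andP[/andP[_ lt] /eqP <-]; rewrite inordK.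
have := CD w; rewrite !split_sum.
rewrite (eq_bigr (fun v : 'I_w => A D v * cube_walks #|Lstar L| w v)%N); last first.
  by move=> v _; rewrite /A IH //; have := ltn_ord v; lia.
by move/addnI/eqP; rewrite eqn_pmul2r ?fact_gt0 // => /eqP.
Qed.

End Words.

(** * Codes with three checks: characters, Walsh sums, moments *)

Section Codes.
Variables (L : finFieldType) (n : nat).
Hypotheses (hL : #|L| = (2 ^ n)%N) (n_odd : odd n).
Implicit Types (c d : word L) (u : L * L * L).

Let n_gt0 : (0 < n)%N := odd_gt0 n_odd.
Local Notation chi := (@chi L n).

Lemma card_Lstar : #|Lstar L| = (2 ^ n - 1)%N.
Proof.
by rewrite -hL card_sig subn1 -(cardC1 (0 : L)); apply: eq_card => x; rewrite !inE.
Qed.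

Lemma csumD c d e : csum (c + d) e = csum c e + csum d e.
Proof.
rewrite /csum -big_split; apply: eq_bigr => x _ /=.
rewrite -mulrDl ffunE; congr (_ * _).
case/orP: (F2_cases (c x)) => /eqP->; case/orP: (F2_cases (d x)) => /eqP-> /=;
  by rewrite ?add0r ?addr0 ?(addLL hL).
Qed.

Lemma csum_delta (x : Lstar L) e : csum (delta x) e = val x ^+ e.
Proof.
rewrite /csum (bigD1 x) //= big1 ?addr0 => [|y yx].
  by rewrite ffunE eqxx mul1r.
by rewrite ffunE (negPf yx) mul0r.
Qed.

Lemma csum0 e : csum (0 : word L) e = 0.
Proof. by rewrite /csum big1 // => x _; rewrite ffunE mul0r. Qed.

Lemma code3D e1 e2 e3 c d :
  c \in code3 L e1 e2 e3 -> d \in code3 L e1 e2 e3 -> c + d \in code3 L e1 e2 e3.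
Proof.
rewrite !inE => /and3P[/eqP c1 /eqP c2 /eqP c3] /and3P[/eqP d1 /eqP d2 /eqP d3].
by rewrite !csumD c1 c2 c3 d1 d2 d3 !addr0 eqxx.
Qed.

Lemma code3_0 e1 e2 e3 : 0 \in code3 L e1 e2 e3.
Proof. by rewrite inE !csum0 eqxx. Qed.

Definition supp c : {set L} := [set val x | x in [set x | c x != 0]].

Lemma supp0 c : 0 \notin supp c.
Proof. by apply/imsetP => -[x _ x0]; have := valP x; rewrite /= -x0 eqxx. Qed.

Lemma card_supp c : #|supp c| = wt c.
Proof. exact: card_imset val_inj. Qed.

Lemma csumE c e : csum c e = \sum_(x in supp c) x ^+ e.
Proof.
rewrite big_imset /=; last by move=> x y _ _; apply: val_inj.
rewrite [RHS]big_mkcond; apply: eq_bigr => x _; rewrite inE.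
by case/orP: (F2_cases (c x)) => /eqP-> /=; rewrite ?mul0r ?mul1r.
Qed.

Definition word_of (X : {set L}) : word L := [ffun x => (val x \in X)%:R].

Lemma supp_word_of (X : {set L}) : 0 \notin X -> supp (word_of X) = X.
Proof.
move=> X0; apply/setP => x; apply/imsetP/idP => [[y]|Xx].
  by rewrite inE ffunE => + ->; case: (_ \in X).
have x0 : x != 0 by apply: contraNneq X0 => <-.
by exists (Sub x x0); rewrite // inE ffunE /= Xx.
Qed.

(** The character of the space of words that pairs [u] with the syndrome of [c]. *)
Definition chr e1 e2 e3 u c : int :=
  chi (u.1.1 * csum c e1 + u.1.2 * csum c e2 + u.2 * csum c e3).

Lemma chrD e1 e2 e3 u : {morph chr e1 e2 e3 u : c d / c + d >-> c * d}.
Proof.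
move=> c d; rewrite /chr !csumD -(chiD hL n_gt0); congr (chi _); ring.
Qed.

Lemma chr0 e1 e2 e3 u : chr e1 e2 e3 u 0 = 1.
Proof. by rewrite /chr !csum0 !mulr0 !addr0 chi0. Qed.

(** The sum factors into three complete sums over [L], each vanishing unless its component of the
    syndrome is 0. *)
Lemma sum_chr e1 e2 e3 c :
  \sum_u chr e1 e2 e3 u c =
  if c \in code3 L e1 e2 e3 then (2 ^ (3 * n))%:Z else 0.
Proof.
rewrite inE /chr; move: (csum c e1) (csum c e2) (csum c e3) => s1 s2 s3.
transitivity (\sum_(a : L) chi (a * s1) * (\sum_(b : L) chi (b * s2))
              * (\sum_(t : L) chi (t * s3))).
  rewrite -(pair_bigA _ (fun ab (t : L) => chi (ab.1 * s1 + ab.2 * s2 + t * s3))).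
  rewrite -(pair_bigA _ (fun a b => \sum_(t : L) chi (a * s1 + b * s2 + t * s3))) /=.
  apply: eq_bigr => a _; rewrite -mulrA mulr_suml mulr_sumr; apply: eq_bigr => b _.
  by rewrite !mulr_sumr; apply: eq_bigr => t _; rewrite !(chiD hL n_gt0) mulrA.
rewrite -!mulr_suml !(sum_chi_mul hL n_gt0 _ n_odd).
do 3 (case: eqP => _; rewrite ?mulr0 ?mul0r //=).
by rewrite -!PoszM -!expnD; congr (Posz (_ ^ _)); lia.
Qed.

(* The sum over [L*] rather than [L]; whence the shift by 1 in the sequel. *)
Definition walsh e1 e2 e3 u : int := \sum_x chr e1 e2 e3 u (delta x).

(** A MacWilliams-type identity: expand the power over walks, then sum over [u] first. *)
Lemma walsh_moment e1 e2 e3 i :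
  \sum_u walsh e1 e2 e3 u ^+ i = (2 ^ (3 * n))%:Z *
    (\sum_(c in code3 L e1 e2 e3) cube_walks #|Lstar L| i (wt c))%:Z.
Proof.
under [LHS]eq_bigr => u _ do
  rewrite (character_sum_expr i (chr0 e1 e2 e3 u) (@chrD e1 e2 e3 u)).
rewrite exchange_big /= (big_morph Posz PoszD (erefl : Posz 0 = 0)) mulr_sumr.
rewrite [RHS]big_mkcond; apply: eq_bigr => c _.
by rewrite -mulr_sumr sum_chr; case: ifP; rewrite ?mulr0 // mulrC.
Qed.

Lemma walsh0 e1 e2 e3 : walsh e1 e2 e3 0 = #|Lstar L|%:Z.
Proof.
rewrite /walsh -[RHS]natz -sumr_const; apply: eq_bigr => x _.
by rewrite /chr !mul0r !addr0 chi0.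
Qed.

Lemma walshE e1 e2 e3 u : (0 < e1)%N -> (0 < e2)%N -> (0 < e3)%N ->
  walsh e1 e2 e3 u =
  \sum_(x : L) chi (u.1.1 * x ^+ e1 + u.1.2 * x ^+ e2 + u.2 * x ^+ e3) - 1.
Proof.
move=> e1_gt0 e2_gt0 e3_gt0; rewrite (bigD1 0) //= !expr0n.
rewrite !gtn_eqF // !mulr0 !addr0 chi0 [RHS]addrC addrA addNr add0r.
transitivity (\sum_(x in [set~ (0 : L)])
  chi (u.1.1 * x ^+ e1 + u.1.2 * x ^+ e2 + u.2 * x ^+ e3)); last first.
  by apply: eq_bigl => x; rewrite !inE.
rewrite (_ : [set~ 0] = [set val x | x in [set: Lstar L]]); last first.
  apply/setP => x; rewrite !inE; apply/idP/imsetP => [x0|[y _ ->]].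
    by exists (Sub x x0).
  exact: (valP y).
rewrite big_imset /=; last by move=> x y _ _; apply: val_inj.
by apply: eq_big => [x|x _]; rewrite ?inE // /chr !csum_delta.
Qed.

Lemma eq_code3_weights e2 e3 e2' e3' (s : seq int) :
  size s = 7%N ->
  (forall c, c \in code3 L 1 e2 e3 -> (wt c <= 6)%N -> c = 0) ->
  (forall c, c \in code3 L 1 e2' e3' -> (wt c <= 6)%N -> c = 0) ->
  (forall u, u != 0 -> walsh 1 e2 e3 u \in s) ->
  (forall u, u != 0 -> walsh 1 e2' e3' u \in s) ->
  forall w, #|[set c in code3 L 1 e2 e3 | wt c == w]| =
            #|[set c in code3 L 1 e2' e3' | wt c == w]|.
Proof.
move=> s7 dC dD sC sD; apply: eq_weight_distribution => i; apply/eqP.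
(* Walks of length at most 6 cannot reach the origin from weight 7 or more, so only the zero word
   contributes. *)
have low_moment (E : {set word L}) j : 0 \in E -> (j <= 6)%N ->
    (forall c, c \in E -> (wt c <= 6)%N -> c = 0) ->
    (\sum_(c in E) cube_walks #|Lstar L| j (wt c) = cube_walks #|Lstar L| j 0)%N.
  move=> E0 j6 dE; rewrite (bigD1 (0 : word L)) //= big1 ?addn0 => [|c /andP[Ec c0]].
    by congr cube_walks; apply/eqP; rewrite wt_eq0.
  apply: cube_walks_gt; rewrite ltnNge; apply: contra c0 => cj; apply/eqP.
  exact: dE Ec (leq_trans cj j6).
have pow_eq0 : (2 ^ (3 * n))%:Z != 0 by rewrite eqz_nat expn_eq0.
rewrite -eqz_nat -(inj_eq (mulfI pow_eq0)) -!walsh_moment; apply/eqP.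
(* Only the values at nonzero [u] are known to lie in [s]; the value at 0 is common to both codes
   and is split off. *)
rewrite (bigD1 (0 : L * L * L)) //= [RHS](bigD1 (0 : L * L * L)) //=.
rewrite !walsh0; congr (_ + _).
apply: (eq_power_sums sC sD) => j; rewrite s7 ltnS => j6.
have : \sum_u walsh 1 e2 e3 u ^+ j = \sum_u walsh 1 e2' e3' u ^+ j.
  by rewrite !walsh_moment !low_moment // code3_0.
rewrite (bigD1 (0 : L * L * L)) //= [RHS](bigD1 (0 : L * L * L)) //= !walsh0.
exact: addrI.
Qed.

(** Double count the sum of all [chr u c]. A nonzero [u] contributes 0: its Walsh sum not being
    maximal, its character is -1 at some unit vector. *)
Lemma card_code3 e1 e2 e3 : (3 * n <= #|Lstar L|)%N ->
  (forall u, u != 0 -> walsh e1 e2 e3 u != #|Lstar L|%:Z) ->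
  #|code3 L e1 e2 e3| = (2 ^ (#|Lstar L| - 3 * n))%N.
Proof.
move=> n3 W; apply/eqP; rewrite -(eqn_pmul2l (m := 2 ^ (3 * n))) ?expn_gt0 //.
rewrite -expnD subnKC // -eqz_nat PoszM.
have -> : #|code3 L e1 e2 e3|%:Z = \sum_(c in code3 L e1 e2 e3) 1.
  by rewrite sumr_const natz.
rewrite mulr_sumr big_mkcond /=; apply/eqP.
under eq_bigr => c _ do rewrite mulr1 -sum_chr.
rewrite exchange_big (bigD1 (0 : L * L * L)) //= [X in _ + X]big1 ?addr0 => [|u u0].
  under eq_bigr => c _ do rewrite /chr !mul0r !addr0 chi0.
  by rewrite sumr_const natz card_ffun card_Fp.
have [x /eqP fx] : exists x, chr e1 e2 e3 u (delta x) == -1.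
  apply/existsP; apply: contraR (W u u0); rewrite negb_exists => /forallP f1.
  rewrite /walsh -natz -sumr_const; apply/eqP/eq_bigr => x _.
  by have := f1 x; rewrite /chr /chi; case: ifP.
apply/eqP; rewrite -eqNr; apply/eqP.
rewrite [in RHS](reindex_inj (addIr (delta x))) -mulN1r mulr_sumr /=.
by apply: eq_bigr => c _; rewrite chrD fx mulrC.
Qed.

(** * Quadratic forms with three Frobenius terms *)

Section ThreeTermForm.
Variables (j1 j2 j3 : nat) (a1 a2 a3 : L).

Definition three_term (y : L) : L :=
  a1 * (y * frob j1 y) + a2 * (y * frob j2 y) + a3 * (y * frob j3 y).

(* [frob (j * n.-1)] is the inverse, hence the adjoint for the trace form, of
   [frob j]. *)
Definition polar (z : L) : L :=
  a1 * frob j1 z + frob (j1 * n.-1) (a1 * z) +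
  (a2 * frob j2 z + frob (j2 * n.-1) (a2 * z)) +
  (a3 * frob j3 z + frob (j3 * n.-1) (a3 * z)).

Lemma frob_adjoint i j (z : L) : frob (i + j) (frob (j * n.-1) z) = frob i z.
Proof.
rewrite frobK -addnA -[X in (_ + (X + _))%N]muln1 -mulnDr add1n prednK //.
by rewrite -frobK (frobMn hL).
Qed.

Lemma chi_adjoint j a y z :
  chi (a * (z * frob j y)) = chi (y * frob (j * n.-1) (a * z)).
Proof.
rewrite -(chi_frob hL n_gt0 j (y * _)) frobM -[X in frob X (frob _ _)]add0n.
by rewrite frob_adjoint frob0r mulrA mulrC.
Qed.

Lemma polarD : {morph polar : x y / x + y}.
Proof. by move=> x y; rewrite /polar !mulrDr !(frobD hL) !mulrDr; ring. Qed.

Lemma chi_three_termD y z :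
  chi (three_term (y + z)) =
  chi (three_term y) * chi (three_term z) * chi (y * polar z).
Proof.
have E j a : chi (a * ((y + z) * frob j (y + z))) =
    chi (a * (y * frob j y)) * chi (a * (z * frob j z)) *
    chi (y * (a * frob j z + frob (j * n.-1) (a * z))).
  rewrite mulrDr [chi (y * _ + _)](chiD hL n_gt0) -chi_adjoint -!(chiD hL n_gt0).
  by congr (chi _); rewrite (frobD hL); ring.
rewrite /three_term /polar !mulrDr !(chiD hL n_gt0) !E !mulrDr !(chiD hL n_gt0); ring.
Qed.

(** The bound on the square serves to tell such a sum from 2^n when the dimension is computed. *)
Lemma three_term_sum :
  (#|[set z | polar z == 0%R]| <= 2 ^ 5)%N ->
  (\sum_y chi (three_term y) \in walsh_values n) /\
  ((\sum_y chi (three_term y)) ^+ 2 <= (2 ^ n * #|[set z | polar z == 0%R]|)%:Z).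
Proof.
move=> K5.
have [r Kr] := card_kernel_pow2 hL polarD.
have [->|E] := quadratic_sum_sqr hL n_gt0 (fun y => chi_pm1 n (three_term y))
  polarD chi_three_termD n_odd.
  by rewrite inE eqxx expr0n; split.
split; last by rewrite E.
apply: (@mem_walsh_values n _ r) => //; last by rewrite -Kr.
by rewrite -(leq_exp2l (m := 2)) // -Kr.
Qed.

End ThreeTermForm.

End Codes.

(** * The BCH code *)

Section BCH.
Variables (L : finFieldType) (n : nat).
Hypotheses (hL : #|L| = (2 ^ n)%N) (n_odd : odd n).
Implicit Types (c : word L) (u : L * L * L).
Let n_gt0 : (0 < n)%N := odd_gt0 n_odd.

Lemma BCH3_min_weight c : c \in BCH3 L -> (wt c <= 6)%N -> c = 0.
Proof.
rewrite inE => /and3P[/eqP c1 /eqP c3 /eqP c5] c6.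
have : supp c = set0.
  by apply: (power_sums135_eq0 hL (supp0 c)); rewrite ?card_supp // -csumE.
by move/eqP; rewrite -cards_eq0 card_supp wt_eq0 => /eqP.
Qed.

(* Since [Tr (a x) = Tr (a^2 x^2)], the linear term counts as a quadratic one. *)
Lemma BCH3_three_term u (x : L) :
  chi n (u.1.1 * x ^+ 1 + u.1.2 * x ^+ 3 + u.2 * x ^+ 5) =
  chi n (three_term 0 1 2 (frob 1 u.1.1) u.1.2 u.2 x).
Proof.
rewrite /three_term !(chiD hL n_gt0) frob0r -expr2 -[x ^+ 2]/(frob 1 x).
by rewrite -frobM (chi_frob hL n_gt0) expr1 /frob -!exprS.
Qed.

(** Applying [frob 2] clears the inverse Frobenius powers, and the term in [a] cancels with
    itself. *)
Lemma BCH3_kernel (a b d : L) : (b != 0) || (d != 0) ->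
  (#|[set z | polar n 0 1 2 (frob 1 a) b d z == 0%R]| <= 2 ^ 4)%N.
Proof.
move=> bd; pose A := nth 0 [:: d; frob 1 b; 0; frob 2 b; frob 2 d].
rewrite (_ : [set z | _] = [set z | \sum_(i < 5) A i * frob (1 * i) z == 0]).
  apply: (card_linearized_roots hL (coprime1n n)).
  case/orP: bd => nz; last by exists 0%N.
  by exists 1%N; rewrite // /A /= frob_eq0.
apply/setP => z; rewrite !inE -(frob_eq0 2); congr (_ == 0).
rewrite /polar mul0n !frob0r (addLL hL) add0r !(frobD hL).
rewrite (frob_adjoint hL n_odd 1 1) (frob_adjoint hL n_odd 0 2) !frob0r.
by rewrite !big_ord_recr big_ord0 /A /= (frobM 2 b) (frobM 2 d) (frobM 1 b)
  !frobK !mul1n frob0r /=; ring.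
Qed.

Lemma BCH3_walsh u : u != 0 -> (5 <= n)%N ->
  walsh n 1 3 5 u \in [seq v - 1 | v <- walsh_values n] /\
  walsh n 1 3 5 u != #|Lstar L|%:Z.
Proof.
case: u => [[a b] d] u0 n5; rewrite walshE // (card_Lstar hL).
have -> : (2 ^ n - 1)%N%:Z = (2 ^ n)%:Z - 1.
  by rewrite -subzn ?expn_gt0.
rewrite (inj_eq (addIr _)).
suff [mem neq] : \sum_x chi n (a * x ^+ 1 + b * x ^+ 3 + d * x ^+ 5) \in walsh_values n
  /\ \sum_x chi n (a * x ^+ 1 + b * x ^+ 3 + d * x ^+ 5) != (2 ^ n)%:Z.
  by split=> //; apply: (map_f (fun v : int => v - 1)) mem.
(* With b = d = 0 the sum is that of a nontrivial additive character. *)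
have [bd0|bd] := boolP ((b == 0) && (d == 0)).
  case/andP: bd0 => /eqP b0 /eqP d0.
  have a0 : a != 0 by apply: contraNneq u0 => ->; rewrite b0 d0.
  rewrite (_ : \sum_x _ = 0) ?inE ?eqxx //.
    by split=> //; rewrite eq_sym eqz_nat expn_eq0.
  rewrite -[RHS](_ : \sum_x chi n (x * a) = 0).
    by apply: eq_bigr => x _; rewrite b0 d0 !mul0r !addr0 expr1 mulrC.
  by rewrite (sum_chi_mul hL n_gt0 _ n_odd) (negPf a0).
rewrite negb_and in bd.
under eq_bigr => x _ do rewrite (BCH3_three_term (a, b, d)).
have K4 := BCH3_kernel a bd.
have K5 : (#|[set z | polar n 0 1 2 (frob 1 a) b d z == 0%R]| <= 2 ^ 5)%N.
  exact: leq_trans K4 _.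
have [? W2] := three_term_sum hL n_odd K5; split=> //.
(* The kernel bound 2^4 is strictly below 2^n, even for n = 5. *)
apply: contraTneq W2 => ->; rewrite -ltNge.
rewrite expr2 -PoszM ltz_nat ltn_pmul2l ?expn_gt0 //.
by apply: leq_ltn_trans K4 _; rewrite ltn_exp2l.
Qed.

(** If the translate by [x] met [s], closure under addition would put [x] in [s]. *)
Lemma double_span (s : seq L) (x : L) : uniq s ->
  {in s &, forall y z, y + z \in s} -> x \notin s ->
  let t := s ++ [seq y + x | y <- s] in
  uniq t /\ {in t &, forall y z, y + z \in t}.
Proof.
move=> us cs xs; split.
  rewrite cat_uniq us (map_inj_uniq (addIr x)) us andbT /= -all_predC.
  apply/allP => _ /mapP[y sy ->] /=; apply: contra xs => /(cs _ _ sy).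
  by rewrite addrA (addLL hL) add0r.
move=> y z; rewrite !mem_cat.
case/orP=> [sy|/mapP[y' sy ->]]; case/orP=> [sz|/mapP[z' sz ->]]; apply/orP.
- by left; apply: cs.
- by right; rewrite addrA; apply/map_f/cs.
- by right; rewrite addrAC; apply: (map_f (fun y => y + x)); apply: cs.
- by left; rewrite addrACA (addLL hL) addr0; apply: cs.
Qed.

(* A three-dimensional binary subspace, punctured at 0, is a codeword. *)
Lemma BCH3_weight7 : (5 <= n)%N -> exists2 c, c \in BCH3 L & wt c = 7%N.
Proof.
move=> n5; have L32 : (32 <= #|L|)%N by rewrite hL -[32%N]/(2 ^ 5)%N leq_exp2l.
have pick_outside (s : seq L) : (size s < 32)%N -> exists x, x \notin s.
  move=> s32; apply/existsP; apply: contraTT s32; rewrite negb_exists => /forallP sA.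
  rewrite -leqNgt (leq_trans L32) // (leq_trans _ (card_size s)) //.
  by apply/subset_leq_card/subsetP => x _; have := sA x; rewrite negbK.
have [a /double_span [//||u1 c1]] := pick_outside [:: 0] isT.
  by move=> y z; rewrite !inE => /eqP-> /eqP->; rewrite addr0.
have [b /(double_span u1 c1) [u2 c2]] := pick_outside [:: 0; 0 + a] isT.
have [d /(double_span u2 c2) [/= /andP[s0 us] _]] :=
  pick_outside [:: 0; 0 + a; 0 + b; 0 + a + b] isT.
set s := [:: 0 + a, _ & _] in s0 us.
have {}us : uniq s := us.
have X0 : 0 \notin [set x in s] by rewrite inE.
exists (word_of [set x in s]); last first.
  by rewrite -card_supp supp_word_of // cardsE (card_uniqP us).
rewrite inE !csumE supp_word_of //.
have sumE e : \sum_(x in [set x in s]) x ^+ e = \sum_(x <- s) x ^+ e.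
  by rewrite big_uniq //; apply: eq_bigl => x; rewrite inE.
rewrite !sumE !big_cons !big_nil; apply/and3P; split; apply/eqP.
(* Over the integers each of the three power sums is twice the polynomial given to [addLL]. *)
- rewrite -[RHS](addLL hL (2 * (a + b + d))); ring.
- rewrite -[RHS](addLL hL (2 * (a ^+ 3 + b ^+ 3 + d ^+ 3)
    + 3 * (a ^+ 2 * b + a * b ^+ 2 + a ^+ 2 * d + a * d ^+ 2 + b ^+ 2 * d + b * d ^+ 2)
    + 3 * (a * b * d))); ring.
- rewrite -[RHS](addLL hL (2 * (a ^+ 5 + b ^+ 5 + d ^+ 5)
    + 5 * (a ^+ 4 * b + a * b ^+ 4 + a ^+ 4 * d + a * d ^+ 4 + b ^+ 4 * d + b * d ^+ 4)
    + 10 * (a ^+ 3 * b ^+ 2 + a ^+ 2 * b ^+ 3 + a ^+ 3 * d ^+ 2 + a ^+ 2 * d ^+ 3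
            + b ^+ 3 * d ^+ 2 + b ^+ 2 * d ^+ 3)
    + 10 * (a ^+ 3 * b * d + a * b ^+ 3 * d + a * b * d ^+ 3)
    + 15 * (a ^+ 2 * b ^+ 2 * d + a ^+ 2 * b * d ^+ 2 + a * b ^+ 2 * d ^+ 2))); ring.
Qed.

End BCH.

(** * The code with Kasami-Welch exponents *)

Section KasamiCode.
Variables (L : finFieldType) (n k : nat).
Hypotheses (hL : #|L| = (2 ^ n)%N) (n_odd : odd n).
Hypotheses (k_gt0 : (0 < k)%N) (kn : coprime k n).
Implicit Types (c : word L) (u : L * L * L).
Let n_gt0 : (0 < n)%N := odd_gt0 n_odd.

Lemma coprime_2k : coprime (2 * k) n.
Proof. by rewrite coprimeMl kn coprime2n n_odd. Qed.

Definition kpow (y : L) : L := y * frob k y.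

(** A quotient v of two nonzero arguments with equal images has [frob k v = v^-1]; so [frob (2 * k)]
    fixes v, and v = 1. *)
Lemma kpow_inj : injective kpow.
Proof.
move=> y z; rewrite /kpow => yz.
have [z0|z0] := eqVneq z 0.
  move/eqP: yz; rewrite z0 mul0r mulf_eq0 frob_eq0 orbb => /eqP ->.
  by [].
pose v := y / z.
have v1 : v * frob k v = 1.
  rewrite /v frobM frobV mulrACA yz -invfM mulfV //.
  by rewrite mulf_neq0 ?frob_eq0.
have vfix : frob (2 * k) v = v.
  have fv0 : frob k v != 0.
    by apply: contraTneq (oner_neq0 L) => fv; rewrite -v1 fv mulr0 eqxx.
  apply: (mulfI fv0); rewrite [RHS]mulrC v1 mul2n -addnn -frobK -frobM v1.
  by rewrite /frob expr1n.
case/orP: (frob_fixP hL coprime_2k vfix) => /eqP v01.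
  by move/eqP: v1; rewrite v01 mul0r eq_sym oner_eq0.
by rewrite -[y](mulfVK z0) -/v v01 mul1r.
Qed.

Lemma kpowE y : kpow y = y ^+ (2 ^ k + 1).
Proof. by rewrite addn1 exprS. Qed.

(** With q = 2^k, (q + 1)(q^2 - q + 1) = q^3 + 1. *)
Lemma kpow_ef y : kpow y ^+ ef k = y * frob (k * 3) y.
Proof.
rewrite kpowE -exprM -exprS; congr (_ ^+ _).
rewrite /ef mulnC [(k * 3)%N]mulnC !expnM.
have : (0 < 2 ^ k)%N by rewrite expn_gt0.
rewrite -!expnM !(mulnC _ k) !expnM; set q := (2 ^ k)%N => q0.
have : (q <= q ^ 2)%N by rewrite leq_pmulr.
rewrite !expnS !expn0 !muln1; nia.
Qed.

(** With q = 2^k, (q + 1)(q^4 - q^3 + q^2 - q + 1) = q^5 + 1. *)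
Lemma kpow_eg y : kpow y ^+ eg k = y * frob (k * 5) y.
Proof.
rewrite kpowE -exprM -exprS; congr (_ ^+ _).
rewrite /eg !(mulnC _ k) !expnM.
have : (0 < 2 ^ k)%N by rewrite expn_gt0.
set q := (2 ^ k)%N => q0.
have h1 : (q <= q ^ 2)%N by rewrite leq_pmulr.
have h3 : (q ^ 3 <= q ^ 4)%N by rewrite leq_pexp2l.
have -> : (q ^ 4 - q ^ 3 + q ^ 2 - q + 1 = (q ^ 4 - q ^ 3) + (q ^ 2 - q) + 1)%N by lia.
(* Adding (q + 1)(q^3 + q) to both sides removes the truncated subtractions. *)
apply/eqP; rewrite -(eqn_add2l ((q + 1) * (q ^ 3 + q)))%N -mulnDr; apply/eqP.
have -> : (q ^ 3 + q + (q ^ 4 - q ^ 3 + (q ^ 2 - q) + 1) = q ^ 4 + q ^ 2 + 1)%N by lia.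
by rewrite !expnS !expn0 !muln1; lia.
Qed.

Local Notation C := (code3 L 1 (ef k) (eg k)).

(** The support is pulled back along the bijection [kpow]. *)
Lemma kasami_min_weight c : c \in C -> (wt c <= 6)%N -> c = 0.
Proof.
rewrite inE => /and3P[/eqP c1 /eqP c3 /eqP c5] c6.
pose S := kpow @^-1: supp c.
have cS : #|S| = wt c.
  rewrite -card_supp; apply: on_card_preimset; apply: onW_bij.
  exact: injF_bij kpow_inj.
have sumS e : csum c e = \sum_(y in S) kpow y ^+ e.
  by rewrite csumE (reindex_inj kpow_inj); apply: eq_bigl => y; rewrite inE.
suff S0 : S = set0 by apply/eqP; rewrite -wt_eq0 -cS S0 cards0.
apply: (kasami_sums_eq0 hL n_gt0 n_odd k_gt0 kn); rewrite ?cS //.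
- by rewrite inE /kpow mul0r; apply: supp0.
- by rewrite -[RHS]c1 sumS; apply: eq_bigr => y _; rewrite expr1.
- by rewrite -[RHS]c3 sumS; apply: eq_bigr => y _; rewrite kpow_ef.
- by rewrite -[RHS]c5 sumS; apply: eq_bigr => y _; rewrite kpow_eg.
Qed.

(** After [frob (k * 5)] the exponents of [frob k] are 5 +- 1, 5 +- 3, 5 +- 5, all even: six terms
    in [frob (2 * k)]. *)
Lemma kasami_kernel (a b d : L) : (a, b, d) != 0 ->
  (#|[set z | polar n (k * 1) (k * 3) (k * 5) a b d z == 0%R]| <= 2 ^ 5)%N.
Proof.
move=> abd; pose A := nth 0 [:: d; frob (k * 2) b; frob (k * 4) a;
  frob (k * 5) a; frob (k * 5) b; frob (k * 5) d].
rewrite (_ : [set z | _] = [set z | \sum_(i < 6) A i * frob (2 * k * i) z == 0]).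
  apply: (card_linearized_roots hL coprime_2k).
  have [a0|] := eqVneq a 0; last by exists 2; rewrite // /A /= frob_eq0.
  have [b0|] := eqVneq b 0; last by exists 1%N; rewrite // /A /= frob_eq0.
  exists 0%N => //; rewrite /A /=; apply: contraNneq abd => d0.
  by rewrite a0 b0 d0.
apply/setP => z; rewrite !inE -(frob_eq0 (k * 5)); congr (_ == 0).
have adj i j w : (i + j = 5)%N ->
    frob (k * 5) (frob (k * j * n.-1) w) = frob (k * i) w :> L.
  by move=> <-; rewrite mulnDr (frob_adjoint hL n_odd).
rewrite /polar !(frobD hL) (adj 4) // (adj 2) // (adj 0%N) // muln0 frob0r.
rewrite (frobM _ a) (frobM _ a) (frobM _ b) (frobM _ b) (frobM _ d) !frobK -!mulnDr.
rewrite !big_ord_recr big_ord0 /A /= muln0 frob0r.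
have e2 i : (2 * k * i = k * (2 * i))%N by rewrite mulnAC mulnC.
by rewrite !e2; ring.
Qed.

Lemma kasami_walsh u : u != 0 ->
  walsh n 1 (ef k) (eg k) u \in [seq v - 1 | v <- walsh_values n].
Proof.
case: u => [[a b] d] u0.
rewrite walshE //; [|by rewrite /ef addn1|by rewrite /eg addn1].
rewrite (reindex_inj kpow_inj); apply: (map_f (fun v : int => v - 1)).
have [mem _] := three_term_sum hL n_odd (kasami_kernel u0).
suff E : \sum_y chi n (a * kpow y ^+ 1 + b * kpow y ^+ ef k + d * kpow y ^+ eg k) =
    \sum_y chi n (three_term (k * 1) (k * 3) (k * 5) a b d y).
  by rewrite -E in mem.
by apply: eq_bigr => y _; rewrite kpow_ef kpow_eg expr1 /three_term muln1.
Qed.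

End KasamiCode.

Theorem theorem2 (n k : nat) (L : finFieldType)
  (hn : odd n) (hn5 : (5 <= n)%N) (hk : (0 < k)%N) (hkn : coprime k n) (hL : #|L| = (2 ^ n)%N) :
  let C := code3 L 1 (ef k) (eg k) in
  [/\ #|Lstar L| = (2 ^ n - 1)%N,
      (* C is a linear code of dimension 2^n - 3n - 1 *)
      (forall c d, c \in C -> d \in C -> c + d \in C),
      #|C| = (2 ^ (2 ^ n - 3 * n - 1))%N,
      min_dist C 7
    & forall w : nat,
        #|[set c in C | wt c == w]| = #|[set c in BCH3 L | wt c == w]| ].
Proof.
move=> C.
have dC c : c \in C -> (wt c <= 6)%N -> c = 0.
  exact: kasami_min_weight hL hn hk hkn c.
have weights w : #|[set c in C | wt c == w]| = #|[set c in BCH3 L | wt c == w]|.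
  apply: (eq_code3_weights hL hn (s := [seq v - 1 | v <- walsh_values n])) => //.
  - exact: BCH3_min_weight hL.
  - exact: kasami_walsh.
  - by move=> u u0; have [] := BCH3_walsh hL hn u0 hn5.
have CD c d : c \in C -> d \in C -> c + d \in C by apply: (code3D hL).
have hdistE (c d : word L) : hdist c d = wt (c + d).
  rewrite /hdist /wt; apply: eq_card => x; rewrite !inE ffunE.
  by rewrite -(inj_eq (addIr (d x))) addF2.
split=> //; first exact: card_Lstar hL.
(* Summing the weight distribution transfers the cardinality from the BCH code. *)
- have -> : #|C| = #|BCH3 L|.
    have split_card (E : {set word L}) :
        #|E| = (\sum_(w < #|Lstar L|.+1) #|[set c in E | wt c == w]|)%N.
      rewrite -sum1_card.
      rewrite (partition_big (fun c => inord (wt c) : 'I_#|Lstar L|.+1) xpredT) //=.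
      apply: eq_bigr => w _; rewrite sum1dep_card; apply: eq_card => c.
      rewrite !inE; congr (_ && _); rewrite -val_eqE /= inordK // ltnS.
      exact: max_card.
    by rewrite !split_card; apply: eq_bigr => w _; apply: weights.
  have n3 : (3 * n <= 2 ^ n - 1)%N.
    have [m ->] : exists m, n = (5 + m)%N by exists (n - 5)%N; lia.
    elim: m => // m; rewrite addnS expnS; lia.
  rewrite (card_code3 hL hn) (card_Lstar hL) //; first by congr (2 ^ _)%N; lia.
  by move=> u u0; rewrite -(card_Lstar hL); have [] := BCH3_walsh hL hn u0 hn5.
- split.
    (* Equal weight distributions turn a BCH word of weight 7 into one of [C]. *)
    have [c0 c0C w7] := BCH3_weight7 hL hn5.
    have : (0 < #|[set c in C | wt c == 7%N]|)%N.
      by rewrite weights; apply/card_gt0P; exists c0; rewrite inE c0C w7 eqxx.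
    case/card_gt0P => c; rewrite inE => /andP[cC /eqP wc].
    exists c, 0; split=> //; first exact: code3_0.
      by apply: contra_eqN wc => /eqP ->; rewrite (eqP (_ : wt 0 == 0%N)) ?wt_eq0.
    by rewrite hdistE addr0.
  move=> c d cC dC' cd; rewrite hdistE ltnNge; apply: contra cd => w6.
  by rewrite -add_word_eq0 (dC _ (CD _ _ cC dC') w6).
Qed.
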